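(* There exists an infinite family of instances, each consisting of a graph $G=(V,E)$ with given clockwise edge orders and a set $L$ of lines, such that every consistent solution has $\Omega(|L|\sqrt{|E'|})$ block crossings in total, where $E'$ is the set of edges used by at least two lines.
   Context: An instance consists of a graph $G=(V,E)$ with a fixed clockwise order of incident edges around each vertex, and a set $L$ of lines, each a simple path in $G$, such that every line has both endpoints at vertices of degree one and no two lines share an endpoint, and the intersection of any two lines is empty or a path. For an edge $e=(u,v)$ let $L_e$ be the set of lines using $e$. A block move exchanges two adjacent consecutive blocks of a sequence. A solution assigns to each edge $e=(u,v)$ a sequence of orderings $\pi^0(e),\dots,\pi^{t(e)}(e)$ of $L_e$ (from near $u$ to near $v$), each obtained from the previous by one block move; $t(e)$ is the number of block crossings on $e$ and the total is $\sum_e t(e)$. It is consistent if at every vertex the orders on the incident edges, combined according to the clockwise edge order, create no crossing at the vertex between two lines sharing an edge. *)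

(* Defs.v *)
From HB Require Import structures.
From mathcomp Require Import all_boot all_order all_algebra.
From mathcomp Require Import reals.

Set Implicit Arguments.
Unset Strict Implicit.
Unset Printing Implicit Defensive.

(* A simple graph on V is given by a set E of pairs containing each edge in   *)
(* exactly one of its two directions; this is the reference direction in the  *)
(* notation e = (u, v) and has no influence on adjacency.                     *)
Definition adj (V : finType) (E : {set V * V}) : rel V :=
  fun u v => ((u, v) \in E) || ((v, u) \in E).

Definition simple_path (V : finType) (E : {set V * V}) (p : seq V) : bool :=
  uniq p && sorted (adj E) p.

Definition degree (V : finType) (E : {set V * V}) (v : V) : nat :=
  #|[set w | adj E v w]|.

Definition is_endpoint (V : eqType) (x : V) (p : seq V) : bool :=
  (ohead p == Some x) || (ohead (rev p) == Some x).

Definition traverses (V : eqType) (p : seq V) (u v : V) : bool :=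
  infix [:: u; v] p || infix [:: v; u] p.

(* The subgraph p meet q is empty (r = [::]) or a path; it may consist of a   *)
(* single vertex.                                                             *)
Definition meet_in_path (V : finType) (E : {set V * V}) (p q : seq V) : Prop :=
  exists r : seq V,
    [/\ simple_path E r,
        forall x, (x \in r) = (x \in p) && (x \in q)
      & forall u v, traverses r u v = traverses p u v && traverses q u v].

Record instance : Type := Instance {
  vertex : finType;
  edges : {set vertex * vertex};
  line : finType;
  route : line -> seq vertex;
  (* the neighbours of v in clockwise order, read cyclically *)
  clockwise : vertex -> seq vertex;
  edges_simple : forall u v, (u, v) \in edges -> u != v /\ (v, u) \notin edges;
  clockwise_uniq : forall v, uniq (clockwise v);
  clockwise_adj : forall v w, (w \in clockwise v) = adj edges v w;
  route_path : forall l, simple_path edges (route l);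
  route_size : forall l, 1 < size (route l);
  route_ends : forall l x, is_endpoint x (route l) -> degree edges x = 1;
  route_ends_inj : forall l m x,
    is_endpoint x (route l) -> is_endpoint x (route m) -> l = m;
  route_meet : forall l m, l != m ->
    meet_in_path edges (route l) (route m)
}.

Definition lines_on (I : instance) (e : vertex I * vertex I) : {set line I} :=
  [set l | traverses (route l) e.1 e.2].

Definition shared_edges (I : instance) : {set vertex I * vertex I} :=
  [set e in edges I | 1 < #|lines_on e|].

Definition share_edge (I : instance) (l m : line I) : Prop :=
  exists2 e, e \in edges I & (l \in lines_on e) && (m \in lines_on e).

Definition block_move (T : Type) (s s' : seq T) : Prop :=
  exists a b c d : seq T,
    [/\ (0 < size b)%N, (0 < size c)%N,
        s = a ++ b ++ c ++ d & s' = a ++ c ++ b ++ d].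

(* For e = (u, v), order e i lists the lines on e from left to right as seen  *)
(* when walking from u to v.  The values of order e i for i > crossings e, or *)
(* for e not in edges I, are irrelevant.                                      *)
Record solution (I : instance) : Type := Solution {
  crossings : vertex I * vertex I -> nat;
  order : vertex I * vertex I -> nat -> seq (line I);
  order_lines : forall e, e \in edges I -> forall i, i <= crossings e ->
    perm_eq (order e i) (enum (lines_on e));
  order_step : forall e, e \in edges I -> forall i, i < crossings e ->
    block_move (order e i) (order e i.+1)
}.

Definition total_crossings (I : instance) (s : solution I) : nat :=
  \sum_(e in edges I) crossings s e.

(* The lines on the edge vw, close to v, in clockwise order around v.  Looking *)
(* away from v, clockwise is left to right; if the reference direction points  *)
(* towards v, left and right are exchanged.                                    *)
Definition order_near (I : instance) (s : solution I) (v w : vertex I) :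
    seq (line I) :=
  if (v, w) \in edges I then order s (v, w) 0
  else rev (order s (w, v) (crossings s (w, v))).

(* The lines met on a small circle walked clockwise around v; a line passing  *)
(* through v occurs twice in it.                                              *)
Definition order_around (I : instance) (s : solution I) (v : vertex I) :
    seq (line I) :=
  flatten [seq order_near s v w | w <- clockwise v].

(* Two lines cross at v iff their occurrences alternate on that circle.  As   *)
(* the circle is read from an arbitrary starting point, both patterns l m l m *)
(* and m l m l count.                                                         *)
Definition cross_at (I : instance) (s : solution I) (v : vertex I)
    (l m : line I) : bool :=
  subseq [:: l; m; l; m] (order_around s v)
  || subseq [:: m; l; m; l] (order_around s v).

Definition consistent (I : instance) (s : solution I) : Prop :=
  forall (v : vertex I) (l m : line I),
    l != m -> share_edge l m -> ~~ cross_at s v l m.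

(* Main.v *)
(* The instances come from the affine planes over finite fields with q         *)
(* elements.  The metro lines are the q^2 lines y = a x + b; each point of the *)
(* plane is replaced by an edge, traversed by the q lines through the point,   *)
(* and at both ends of this edge the lines fan out along edges of their own,   *)
(* because two points lie on at most one common line.  If both fans list the   *)
(* lines in the same order, consistency forces the order on the edge to be     *)
(* reversed between its ends.  A block move changes only three adjacencies, so *)
(* it creates at most three ascents, and reversing q lines takes at least      *)
(* (q - 1) / 3 block moves.  There are at least q^2 shared edges, whence the   *)
(* bound q |E'| / 6 >= |L| sqrt |E'| / 6.                                      *)

Require Import Defs.
From HB Require Import structures.
From mathcomp Require Import all_boot all_order all_algebra.
From mathcomp Require Import reals.
From mathcomp Require Import zify ring.

Set Implicit Arguments.
Unset Strict Implicit.
Unset Printing Implicit Defensive.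

Import Order.TTheory GRing.Theory Num.Theory.

(** In the plane over a field with q elements, two lines share at most one point, while every point
    lies on a line of each of the q slopes ([column_color_sep], [card_lines_on_point]). A point
    stretched to an edge thus carries q lines that all separate at both of its ends. A reference
    order [before] on the lines fixes both fans. Since clockwise reading reverses direction between
    the two ends, noncrossing makes the order on the edge decreasing at one end and increasing at
    the other ([order_opposite_fan]). The number of ascents must climb from 0 to q - 1, and a block
    move adds at most 3 ([ascents_block_move], [layered_crossings]). Summing over the shared edges,
    which are exactly the point edges ([shared_plane_point]), gives [plane_total_crossings]. *)

Section Sequences.

(** * Adjacent pairs, subsequences and ascents *)

Variable T : eqType.
Implicit Types (s : seq T) (r : rel T).

Lemma infix_pairP s x0 u v :
  reflect (exists2 k, k.+1 < size s & u = nth x0 s k /\ v = nth x0 s k.+1)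
          (infix [:: u; v] s).
Proof.
apply: (iffP (@infixP _ _ _)) => [[s1 [s2 ->]]|[k lt_k [-> ->]]].
  exists (size s1); first by rewrite !size_cat /=; lia.
  by rewrite !nth_cat ltnn subnn /= ltnNge leqnSn subSnn.
exists (take k s), (drop k.+2 s).
rewrite -{1}(cat_take_drop k s); congr (_ ++ _).
by rewrite (drop_nth x0) ?(ltnW lt_k) // (drop_nth x0) // (drop_nth x0).
Qed.

Lemma subseq_index2 s x y :
  y \in s -> index x s < index y s -> subseq [:: x; y] s.
Proof.
move=> ys lt_xy; rewrite -(cat_take_drop (index y s) s).
apply: (@cat_subseq _ [:: x] [:: y]); rewrite sub1seq.
  rewrite in_take //.
  by rewrite -index_mem (ltn_trans lt_xy) // index_mem.
by rewrite (drop_nth y) ?index_mem // nth_index // mem_head.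
Qed.

Lemma subseq_flatten (t t' : seq (seq T)) :
  subseq t t' -> subseq (flatten t) (flatten t').
Proof.
elim: t' t => [|x t' IH] [|y t] //= ; first by rewrite sub0seq.
case: eqP => [->|_] sub_t; first by rewrite subseq_cat2l IH.
exact: subseq_trans (IH _ sub_t) (suffix_subseq _ _).
Qed.

Fixpoint ascents r s : nat :=
  if s is x :: s' then (if s' is y :: _ then r x y : nat else 0) + ascents r s'
  else 0.

Lemma ascents_cat r s1 s2 :
  ascents r s1 + ascents r s2 <= ascents r (s1 ++ s2)
    <= ascents r s1 + ascents r s2 + 1.
Proof.
elim: s1 => [|x [|y s1] IH] /=; first by lia.
  by case: s2 {IH} => //= y s2; case: (r x y); lia.
by move: IH => /=; lia.
Qed.

(** The four blocks keep their inner adjacencies; only the three junctions are new, and each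
    contributes at most one ascent. *)
Lemma ascents_block_move r s s' :
  block_move s s' -> ascents r s' <= ascents r s + 3.
Proof.
case=> a [b [c [d [_ _ -> ->]]]].
have := ascents_cat r a (b ++ c ++ d); have := ascents_cat r b (c ++ d).
have := ascents_cat r c d; have := ascents_cat r a (c ++ b ++ d).
have := ascents_cat r c (b ++ d); have := ascents_cat r b d.
by lia.
Qed.

Lemma ascents_moves r (o : nat -> seq T) t :
  (forall i, i < t -> block_move (o i) (o i.+1)) ->
  ascents r (o t) <= ascents r (o 0) + 3 * t.
Proof.
elim: t => [|t IH] moves; first by lia.
have := ascents_block_move r (moves t (ltnSn t)).
have := IH (fun i lt_it => moves i (ltnW lt_it)).
by lia.
Qed.

Lemma ascents_eq0 r s :
  (forall x y, subseq [:: x; y] s -> ~~ r x y) -> ascents r s = 0.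
Proof.
elim: s => [//|x s IH] no_asc /=.
rewrite IH => [|y z yz]; last first.
  by apply: no_asc; apply: subseq_trans yz (subseq_cons _ _).
case: s {IH} no_asc => //= y s no_asc.
by rewrite (negPf (no_asc x y _)) //= !eqxx sub0seq.
Qed.

Lemma ascents_max r s :
  (forall x y, subseq [:: x; y] s -> r x y) -> ascents r s = (size s).-1.
Proof.
elim: s => [//|x s IH] asc /=.
rewrite IH => [|y z yz]; last first.
  by apply: asc; apply: subseq_trans yz (subseq_cons _ _).
case: s {IH} asc => //= y s asc.
by rewrite (asc x y) //= !eqxx sub0seq.
Qed.

End Sequences.

(** * Noncrossing at a vertex with a fan *)

Section Consistency.

Variables (I : instance) (s : solution I).
Implicit Types (v w : vertex I) (l m : line I).

(** The reference order in which the fans are laid out and against which ascents are counted. *)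
Definition before l m := index l (enum (line I)) < index m (enum (line I)).

Lemma traversesC (V : eqType) (p : seq V) (u v : V) :
  traverses p u v = traverses p v u.
Proof. exact: orbC. Qed.

Lemma mem_order_near v w l : adj (edges I) v w ->
  (l \in order_near s v w) = traverses (route l) v w.
Proof.
rewrite /adj /order_near; case: ifP => /= [vw _|_ wv].
  by rewrite (perm_mem (order_lines vw (leq0n _))) mem_enum inE.
by rewrite mem_rev (perm_mem (order_lines wv (leqnn _))) mem_enum inE traversesC.
Qed.

Lemma order_near_uniq v w : adj (edges I) v w -> uniq (order_near s v w).
Proof.
rewrite /adj /order_near; case: ifP => /= [vw _|_ wv].
  by rewrite (perm_uniq (order_lines vw (leq0n _))) enum_uniq.
by rewrite rev_uniq (perm_uniq (order_lines wv (leqnn _))) enum_uniq.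
Qed.

(** Distinct lines use distinct exits, so [undup] removes nothing and the fan inherits the order of
    the enumeration. *)
Lemma fan_order v (P : pred (line I)) (exit : line I -> vertex I)
    (fan := undup [seq exit l | l <- enum (line I) & P l]) l m :
  {in P &, injective exit} ->
  (forall l', P l' -> l' \in order_near s v (exit l')) ->
  P l -> P m -> before l m ->
  subseq [:: l; m] (flatten [seq order_near s v w | w <- fan]).
Proof.
move=> exit_inj mem_exit Pl Pm lm.
have fanE : fan = [seq exit l' | l' <- enum (line I) & P l'].
  rewrite /fan undup_id // map_inj_in_uniq => [|x y].
    exact/filter_uniq/enum_uniq.
  by rewrite !mem_filter => /andP[Px _] /andP[Py _]; apply: exit_inj.
have sub_fan : subseq [:: exit l; exit m] fan.
  rewrite fanE; apply: (@map_subseq _ _ exit [:: l; m]).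
  by rewrite subseq_filter /= Pl Pm subseq_index2 ?mem_enum.
apply: subseq_trans (subseq_flatten (map_subseq (order_near s v) sub_fan)).
rewrite /= cats0; apply: (@cat_subseq _ [:: l] [:: m]);
  by rewrite sub1seq mem_exit.
Qed.

(* Every line through vw leaves v, on the other side, along an edge of its own. *)
(* Noncrossing at v makes the order on vw the reverse of the fan's order.       *)
Lemma order_opposite_fan v w (P : pred (line I)) (exit : line I -> vertex I)
    (fan := undup [seq exit l | l <- enum (line I) & P l]) rest :
  consistent s ->
  clockwise v = fan ++ rest \/ clockwise v = rest ++ fan -> w \in rest ->
  {in P &, injective exit} ->
  (forall l, P l -> l \in order_near s v (exit l)) ->
  (forall l, traverses (route l) v w -> P l) ->
  forall l m, subseq [:: l; m] (order_near s v w) -> ~~ before l m.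
Proof.
move=> s_cons cw_v w_rest exit_inj mem_exit P_vw l m sub_lm.
have vw : adj (edges I) v w.
  by rewrite -clockwise_adj; case: cw_v => ->; rewrite mem_cat w_rest ?orbT.
have neq_lm : l != m.
  by have := subseq_uniq sub_lm (order_near_uniq vw); rewrite /= inE andbT.
have lvw : traverses (route l) v w.
  by rewrite -mem_order_near // (mem_subseq sub_lm) // mem_head.
have mvw : traverses (route m) v w.
  by rewrite -mem_order_near // (mem_subseq sub_lm) // inE mem_head orbT.
have share : share_edge l m.
  case/orP: vw => e_in; [exists (v, w) | exists (w, v)] => //;
  by rewrite !inE /= ?[traverses _ w v]traversesC lvw.
apply/negP => lm; have /negP[] := s_cons v l m neq_lm share.
have sub_fan := fan_order exit_inj mem_exit (P_vw l lvw) (P_vw m mvw) lm.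
have sub_rest : subseq [:: l; m] (flatten [seq order_near s v x | x <- rest]).
  apply: subseq_trans sub_lm _; rewrite -[order_near s v w]cats0.
  apply: (@subseq_flatten _ [:: order_near s v w]).
  by rewrite sub1seq map_f.
rewrite /cross_at /order_around; apply/orP; left.
by case: cw_v => ->; rewrite map_cat flatten_cat;
  apply: (@cat_subseq _ [:: l; m] [:: l; m]).
Qed.

End Consistency.

(** * Instances whose lines run through successive layers *)

Section Layered.

Variables (L C : finType) (N : nat) (color : nat -> L -> C).

(* Line l passes through the layers 0, ..., N in turn, and in layer k it meets *)
(* exactly the lines of its colour.                                            *)
Definition stop k l : 'I_N.+1 * C := (inord k, color k l).

Definition layered_edges : {set ('I_N.+1 * C) * ('I_N.+1 * C)} :=
  [set (stop k l, stop k.+1 l) | k : 'I_N, l : L].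

Definition layered_route l := [seq stop k l | k <- iota 0 N.+1].

(** Both fans follow [enum L], which is what forces the reversal. Lines with a common neighbour are
    merged by [undup]; the guards exclude the missing layers beyond 0 and N. *)
Definition layered_clockwise (v : 'I_N.+1 * C) : seq ('I_N.+1 * C) :=
  undup [seq stop v.1.-1 l | l <- enum L & (0 < v.1) && (v == stop v.1 l)]
  ++ undup [seq stop v.1.+1 l | l <- enum L & (v.1 < N) && (v == stop v.1 l)].

(** Presents a whole route as the case i = 0, j = N + 1 of the route segments treated below. *)
Lemma layered_routeE l :
  layered_route l = [seq stop k l | k <- iota 0 (N.+1 - 0)].
Proof. by rewrite subn0. Qed.

Lemma stop_layer k l : k <= N -> (stop k l).1 = k :> nat.
Proof. by move=> le_kN; rewrite inordK. Qed.

Lemma stop_inj k l k' l' : k <= N -> k' <= N -> stop k l = stop k' l' ->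
  k = k' /\ color k l = color k l'.
Proof.
move=> leN leN' eq_st.
have eq_k: k = k' by rewrite -(stop_layer l leN) eq_st stop_layer.
by case: eq_st => _; rewrite -eq_k.
Qed.

Lemma eq_stop k l l' : (stop k l == stop k l') = (color k l == color k l').
Proof. by rewrite xpair_eqE eqxx. Qed.

Lemma layered_edgesP u v :
  reflect (exists k l, [/\ k < N, u = stop k l & v = stop k.+1 l])
          ((u, v) \in layered_edges).
Proof.
apply: (iffP imset2P) => [[k l _ _ [-> ->]]|[k [l [lt_kN -> ->]]]].
  by exists k, l.
by exists (Ordinal lt_kN) l.
Qed.

Lemma adj_layeredP u v :
  reflect (exists k l, k < N /\
            ((u = stop k l /\ v = stop k.+1 l)
             \/ (v = stop k l /\ u = stop k.+1 l)))
          (adj layered_edges u v).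
Proof.
apply: (iffP orP).
  by case=> /layered_edgesP [k [l [? ? ?]]]; exists k, l; intuition.
by case=> k [l [? [[-> ->]|[-> ->]]]]; [left|right]; apply/layered_edgesP;
  exists k, l.
Qed.

Lemma stops_infixP i j l u v :
  reflect (exists k, [/\ i <= k, k.+1 < j, u = stop k l & v = stop k.+1 l])
          (infix [:: u; v] [seq stop k l | k <- iota i (j - i)]).
Proof.
apply: (iffP (infix_pairP _ u _ _)); rewrite size_map size_iota.
  case=> k lt_k []; rewrite !(nth_map 0) ?size_iota ?nth_iota ?(ltnW lt_k) //.
  by rewrite addnS => -> ->; exists (i + k); split=> //; lia.
case=> k [le_ik lt_kj eu ev]; exists (k - i); first by lia.
rewrite !(nth_map 0) ?size_iota ?nth_iota; try lia.
by rewrite addnS subnKC.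
Qed.

Lemma traverses_stopsP i j l u v :
  reflect (exists k, [/\ i <= k, k.+1 < j &
             (u = stop k l /\ v = stop k.+1 l)
             \/ (v = stop k l /\ u = stop k.+1 l)])
          (traverses [seq stop k l | k <- iota i (j - i)] u v).
Proof.
apply: (iffP orP).
  by case=> /stops_infixP [k [? ? ? ?]]; exists k; split=> //; [left|right].
case=> k [? ? [[? ?]|[? ?]]]; [left|right]; apply/stops_infixP;
  by exists k.
Qed.

Lemma traverses_edge k l m : k < N ->
  traverses (layered_route m) (stop k l) (stop k.+1 l)
    = (color k m == color k l) && (color k.+1 m == color k.+1 l).
Proof.
move=> lt_kN; rewrite layered_routeE.
apply/traverses_stopsP/andP => [[k' [_ lt_k' []]]|[/eqP e1 /eqP e2]].
- case=> /stop_inj[||<- ->]; try lia; case/stop_inj=> [||_ ->]; try lia.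
  by rewrite !eqxx.
- by case=> /stop_inj[||e1 _]; try lia; case/stop_inj; lia.
- by exists k; split=> //; left; rewrite /stop e1 e2.
Qed.

Lemma simple_path_stops i j l : j <= N.+1 ->
  simple_path layered_edges [seq stop k l | k <- iota i (j - i)].
Proof.
move=> le_jN; apply/andP; split.
  rewrite map_inj_in_uniq ?iota_uniq // => k k'.
  by rewrite !mem_iota => lt_k lt_k' /stop_inj [] //; lia.
apply/(sortedP (stop 0 l)) => k; rewrite size_map size_iota => lt_k.
rewrite !(nth_map 0) ?size_iota ?nth_iota; try lia.
apply/adj_layeredP; exists (i + k), l; rewrite addnS; split; first by lia.
by left.
Qed.

Hypothesis N_gt0 : 0 < N.
Hypothesis color_first_inj : injective (color 0).
Hypothesis color_last_inj : injective (color N).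
Hypothesis color_meet : forall l m, l != m -> exists i j, j <= N.+1 /\
  forall k, k <= N -> (color k l == color k m) = (i <= k < j).

Lemma layered_simple u v : (u, v) \in layered_edges ->
  u != v /\ (v, u) \notin layered_edges.
Proof.
case/layered_edgesP=> k [l [lt_kN -> ->]]; split.
  by apply/eqP => /stop_inj []; lia.
apply/layered_edgesP => [] [k' [l' [lt_k' /stop_inj []]]]; try lia.
by move=> ? _ /stop_inj []; lia.
Qed.

Lemma layered_clockwise_adj v w :
  (w \in layered_clockwise v) = adj layered_edges v w.
Proof.
have lt_v := ltn_ord v.1.
rewrite mem_cat !mem_undup.
apply/orP/adj_layeredP => [[] /mapP [l]|[k [l [lt_kN [[ev ew]|[ew ev]]]]]].
- rewrite mem_filter => /andP[/andP[v_gt0 /eqP ev] _] ->.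
  exists v.1.-1, l; split; first by lia.
  by right; split=> //; rewrite prednK.
- rewrite mem_filter => /andP[/andP[v_lt /eqP ev] _] ->.
  by exists v.1, l; split=> //; left.
- have e1 : v.1 = k :> nat by rewrite ev stop_layer // ltnW.
  right; apply/mapP; exists l; last by rewrite e1.
  by rewrite mem_filter mem_enum e1 lt_kN ev eqxx.
- have e1 : v.1 = k.+1 :> nat by rewrite ev stop_layer.
  left; apply/mapP; exists l; last by rewrite e1.
  by rewrite mem_filter mem_enum e1 ev eqxx.
Qed.

Lemma layered_clockwise_uniq v : uniq (layered_clockwise v).
Proof.
have lt_v := ltn_ord v.1.
rewrite cat_uniq !undup_uniq andbT /=; apply/hasPn => w.
rewrite !mem_undup => /mapP[l]; rewrite mem_filter => /andP[/andP[? _] _] ->.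
apply/mapP => [] [m]; rewrite mem_filter => /andP[/andP[? _] _].
by case/stop_inj; lia.
Qed.

Lemma layered_route_path l : simple_path layered_edges (layered_route l).
Proof. by rewrite layered_routeE simple_path_stops. Qed.

Lemma layered_route_size l : 1 < size (layered_route l).
Proof. by rewrite size_map size_iota. Qed.

Lemma is_endpoint_layered l v :
  is_endpoint v (layered_route l) -> v = stop 0 l \/ v = stop N l.
Proof.
case/orP; first by case/eqP=> <-; left.
have iotaS : iota 0 N.+1 = rcons (iota 0 N) N by rewrite -addn1 iotaD cats1.
by rewrite /layered_route iotaS map_rcons rev_rcons => /eqP[<-]; right.
Qed.

Lemma layered_route_ends l v :
  is_endpoint v (layered_route l) -> degree layered_edges v = 1.
Proof.
case/is_endpoint_layered=> ->.
  rewrite /degree; apply/eqP/cards1P; exists (stop 1 l); apply/setP => w.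
  rewrite !inE; apply/adj_layeredP/eqP => [|->]; last by exists 0, l; split=> //; left.
  case=> k [m [lt_k [[/stop_inj[||<- /color_first_inj <-]]|[_]]]] //; try lia.
  by case/stop_inj; lia.
rewrite /degree; apply/eqP/cards1P; exists (stop N.-1 l); apply/setP => w.
rewrite !inE; apply/adj_layeredP/eqP => [|->]; last first.
  by exists N.-1, l; split; [lia | right; rewrite prednK].
case=> k [m [lt_k [[]|[-> ]]]]; first by case/stop_inj; lia.
by case/stop_inj=> // eN /color_last_inj ->; have -> : k = N.-1 by lia.
Qed.

Lemma layered_route_ends_inj l m v : is_endpoint v (layered_route l) ->
  is_endpoint v (layered_route m) -> l = m.
Proof.
case/is_endpoint_layered=> -> /is_endpoint_layered[] /stop_inj[] //; try lia.
  by move=> _ /color_first_inj.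
by move=> _ /color_last_inj.
Qed.

(** A vertex or edge determines its layers, so two routes meet exactly over the interval of layers
    on which their colours agree. *)
Lemma layered_route_meet l m : l != m ->
  meet_in_path layered_edges (layered_route l) (layered_route m).
Proof.
case/color_meet=> i [j [le_jN colorE]].
exists [seq stop k l | k <- iota i (j - i)]; split.
- exact: simple_path_stops.
- move=> v; apply/mapP/andP => [[k]|[/mapP[k]]].
    rewrite mem_iota => k_in ->; have le_kN : k <= N by lia.
    split; apply/mapP; exists k; rewrite ?mem_iota //.
    by congr pair; apply/eqP; rewrite colorE //; lia.
  rewrite mem_iota => k_in -> /mapP[k']; rewrite mem_iota => k'_in.
  case/stop_inj; [lia | lia |] => _ /eqP; rewrite colorE; last by lia.
  by move=> k_ij; exists k => //; rewrite mem_iota; lia.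
- move=> u v; apply/traverses_stopsP/andP.
    case=> k [le_ik lt_kj uv].
    have ek : color k l = color k m by apply/eqP; rewrite colorE; lia.
    have ek1 : color k.+1 l = color k.+1 m by apply/eqP; rewrite colorE; lia.
    rewrite !layered_routeE.
    split; apply/traverses_stopsP; exists k; split=> //; try lia.
    by rewrite /stop -ek -ek1.
  rewrite !layered_routeE.
  case=> /traverses_stopsP [k [_ lt_kN uv]] /traverses_stopsP [k' [_ lt_kN' uv']].
  exists k; suff /andP : (color k l == color k m) && (color k.+1 l == color k.+1 m).
    by rewrite !colorE; try lia; case=> ? ?; split=> //; lia.
  case: uv uv' => [[-> ->]|[-> ->]] [[]|[]]; case/stop_inj; try lia;
    move=> ek c1 /stop_inj[]; try lia; move=> _ c2; by rewrite c1 c2 !eqxx.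
Qed.

Definition layered : instance :=
  Instance layered_simple layered_clockwise_uniq layered_clockwise_adj
    layered_route_path layered_route_size layered_route_ends
    layered_route_ends_inj layered_route_meet.

Lemma layered_clockwise_stop k l : 0 < k < N ->
  layered_clockwise (stop k l)
    = undup [seq stop k.-1 m | m <- enum L & stop k l == stop k m]
      ++ undup [seq stop k.+1 m | m <- enum L & stop k l == stop k m].
Proof.
case/andP=> k_gt0 lt_kN.
by rewrite /layered_clockwise stop_layer ?(ltnW lt_kN) // k_gt0 lt_kN.
Qed.

Lemma mem_undup_stops k k' l :
  stop k' l \in undup [seq stop k' m | m <- enum L & stop k l == stop k m].
Proof. by rewrite mem_undup map_f // mem_filter eqxx mem_enum. Qed.

Lemma mem_order_stop (s : solution layered) k l : k < N ->
  (l \in order_near s (stop k l) (stop k.+1 l))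
  * (l \in order_near s (stop k.+1 l) (stop k l)).
Proof.
move=> lt_kN; have adj_k : adj (edges layered) (stop k l) (stop k.+1 l).
  by apply/adj_layeredP; exists k, l; split=> //; left.
split; rewrite (@mem_order_near layered) //= ?[traverses _ (stop k.+1 l) _]traversesC;
  by rewrite ?traverses_edge ?eqxx // /adj orbC.
Qed.

Lemma layered_crossings (s : solution layered) k l0
    (e : vertex layered * vertex layered := (stop k l0, stop k.+1 l0)) :
  consistent s -> 0 < k -> k.+1 < N ->
  (forall l m, color k l = color k m -> color k.-1 l = color k.-1 m -> l = m) ->
  (forall l m, color k.+1 l = color k.+1 m ->
     color k.+2 l = color k.+2 m -> l = m) ->
  #|lines_on e| <= (3 * crossings s e).+1.
Proof.
move=> s_cons k_gt0 lt_k1N fan_in fan_out.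
have lt_kN := ltnW lt_k1N.
have e_in : e \in edges layered by apply/layered_edgesP; exists k, l0.
have eC_in : (e.2, e.1) \notin edges layered by case: (layered_simple e_in).
set t := crossings s e.
have near_u : order_near s e.1 e.2 = Defs.order s e 0 by rewrite /order_near e_in.
have near_v : order_near s e.2 e.1 = rev (Defs.order s e t).
  by rewrite /order_near (negPf eC_in).
(* Near the start of the edge, the opposite fan goes back to layer k - 1. *)
have desc l m : subseq [:: l; m] (Defs.order s e 0) -> ~~ before l m.
  rewrite -near_u; move: l m.
  apply: (@order_opposite_fan layered s e.1 e.2
    (fun l => stop k l0 == stop k l) (stop k.-1)) s_cons _ _ _ _ _.
  - by left; apply: layered_clockwise_stop; rewrite k_gt0.
  - exact: mem_undup_stops.
  - move=> x y; rewrite /in_mem /= !eq_stop => /eqP ex /eqP ey /stop_inj[||_].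
    + lia.
    + lia.
    + by apply: fan_in; rewrite -ex.
  - move=> x /eqP; rewrite /e /= => ->; rewrite -{1}(prednK k_gt0) mem_order_stop //; lia.
  - move=> x; rewrite traverses_edge // => /andP[/eqP cx _].
    by rewrite eq_stop cx.
have asc l m : subseq [:: l; m] (Defs.order s e t) -> before l m.
  move=> sub_lm; have neq_lm : l != m.
    have := subseq_uniq sub_lm; rewrite (perm_uniq (order_lines e_in (leqnn _))).
    by rewrite enum_uniq /= inE andbT; apply.
  suff : ~~ before m l.
    rewrite /before -leqNgt leq_eqVlt => /predU1P[|//].
    move/(congr1 (nth l (enum (line layered)))).
    by rewrite !nth_index ?mem_enum // => /eqP; rewrite (negPf neq_lm).
  (* Seen from the far end the order is reversed, so the same fan argument, now with layer k + 2,
     gives the opposite monotonicity. *)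
  move: sub_lm; rewrite -subseq_rev -near_v; move: m l {neq_lm}.
  apply: (@order_opposite_fan layered s e.2 e.1
    (fun l => stop k.+1 l0 == stop k.+1 l) (stop k.+2)) s_cons _ _ _ _ _.
  - by right; apply: layered_clockwise_stop.
  - exact: mem_undup_stops.
  - move=> x y; rewrite /in_mem /= !eq_stop => /eqP ex /eqP ey /stop_inj[||_].
    + lia.
    + lia.
    + by apply: fan_out; rewrite -ex.
  - by move=> x /eqP; rewrite /e /= => ->; rewrite mem_order_stop.
  - move=> x; rewrite traversesC traverses_edge // => /andP[_ /eqP cx].
    by rewrite eq_stop cx.
have := @ascents_moves _ (@before layered) (Defs.order s e) t (order_step e_in).
rewrite (ascents_eq0 desc) (ascents_max asc).
by rewrite (perm_size (order_lines e_in (leqnn _))) -cardE; lia.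
Qed.

End Layered.

(** * The affine plane as a layered instance *)

Section AffinePlane.

Local Open Scope ring_scope.

Variable F : finFieldType.
Definition plane_order : nat := #|F|.
Local Notation q := plane_order.

Definition coord (c : nat) : F := nth 0 (enum F) c.-1.

(* A pair (a, b) stands for the line y = a x + b.  The columns 1, ..., q hold  *)
(* the points of the plane, as pairs (y, 0); in the two outer columns every    *)
(* line has a vertex of its own.                                               *)
Definition column_color (c : nat) (l : F * F) : F * F :=
  if (0 < c <= q)%N then (l.1 * coord c + l.2, 0) else l.

Lemma coord_inj c c' : (0 < c <= q)%N -> (0 < c' <= q)%N ->
  coord c = coord c' -> c = c'.
Proof.
have size_enum : size (enum F) = q by rewrite -cardT.
move=> c_in c'_in /eqP; rewrite /coord nth_uniq ?enum_uniq ?size_enum; lia.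
Qed.

(** For inner columns, subtracting the two incidence equations isolates the slope times a nonzero
    difference of abscissas; an outer column identifies the line outright. *)
Lemma column_color_sep c c' l m : c != c' ->
  column_color c l = column_color c m ->
  column_color c' l = column_color c' m -> l = m.
Proof.
rewrite /column_color; case: ifP => // c_in neq_c; case: ifP => // c'_in.
case: l m => [a b] [a' b'] [/= e] [e'].
have neq_x : coord c - coord c' != 0.
  by rewrite subr_eq0; apply: contraNneq neq_c => /coord_inj ->.
have ea : a = a'.
  apply: (mulIf neq_x).
  have -> : a * (coord c - coord c')
    = (a * coord c + b) - (a * coord c' + b) by ring.
  by rewrite e e'; ring.
by move: e; rewrite ea => /addrI ->.
Qed.

(* Column c consists of the layers 2c-1 and 2c: its points become edges. *)
Definition plane_color (k : nat) : F * F -> F * F := column_color (uphalf k).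

Lemma column_color_outer c : ~~ (0 < c <= q)%N -> injective (column_color c).
Proof. by rewrite /column_color => /negPf -> l m. Qed.

Lemma plane_first_inj : injective (plane_color 0).
Proof. exact: column_color_outer. Qed.

Lemma plane_last_inj : injective (plane_color q.*2.+1).
Proof. by apply: column_color_outer; lia. Qed.

Lemma plane_meet (l m : F * F) : l != m ->
  exists i j, (j <= q.*2.+2)%N /\ forall k, (k <= q.*2.+1)%N ->
    (plane_color k l == plane_color k m) = (i <= k < j)%N.
Proof.
move=> neq_lm.
case: (pickP (fun c : 'I_q.+1 => column_color c l == column_color c m)).
  move=> c /eqP meet_c.
  have c_in : (0 < c <= q)%N.
    apply: contraT => /column_color_outer c_inj.
    by rewrite (c_inj _ _ meet_c) eqxx in neq_lm.
  (* The half-open interval consists of the two layers of column [c]. *)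
  exists c.*2.-1, c.*2.+1; split=> [|k _]; first by lia.
  rewrite /plane_color; have [kc|neq_kc] := eqVneq (uphalf k) c.
    by rewrite kc meet_c eqxx; lia.
  transitivity false; last by lia.
  apply: contraNF neq_lm => /eqP meet_k.
  by rewrite (column_color_sep neq_kc meet_k meet_c).
(* Parallel lines: the empty interval. *)
move=> no_meet; exists 0, 0; split=> // k le_k; rewrite andbF.
have [lt_k|ge_k] := ltnP (uphalf k) q.+1; first exact: no_meet (Ordinal lt_k).
by rewrite /plane_color /column_color [(_ <= q)%N]leqNgt ge_k andbF (negPf neq_lm).
Qed.

Definition plane : instance :=
  layered (ltn0Sn _) plane_first_inj plane_last_inj plane_meet.

(** The point of [l] in column t + 1; [t] counts the inner columns from 0. *)
Definition point_edge (t : nat) (l : F * F) : vertex plane * vertex plane :=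
  (stop q.*2.+1 plane_color t.*2.+1 l, stop q.*2.+1 plane_color t.*2.+2 l).

Lemma point_edge_in t l : (t < q)%N -> point_edge t l \in edges plane.
Proof.
by move=> lt_t; apply/layered_edgesP; exists t.*2.+1, l; split=> //; lia.
Qed.

Lemma plane_color_point t l : (t < q)%N ->
  (plane_color t.*2.+1 l = (l.1 * coord t.+1 + l.2, 0))
  * (plane_color t.*2.+2 l = (l.1 * coord t.+1 + l.2, 0)).
Proof.
move=> lt_t; rewrite /plane_color.
have -> : uphalf t.*2.+1 = t.+1 by lia.
have -> : uphalf t.*2.+2 = t.+1 by lia.
by rewrite /column_color lt_t.
Qed.

Lemma card_lines_on_point t l : (t < q)%N -> (q <= #|lines_on (point_edge t l)|)%N.
Proof.
move=> lt_t.
(* One line through the point for each slope [a]. *)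
pose through (a : F) : line plane := (a, l.1 * coord t.+1 + l.2 - a * coord t.+1).
have through_inj : injective through by move=> a b [].
rewrite /plane_order -(card_codom through_inj).
apply/subset_leq_card/subsetP => _ /codomP[a ->].
rewrite inE /= traverses_edge; last by lia.
rewrite !plane_color_point //= !xpair_eqE eqxx andbT andbb.
by apply/eqP; ring.
Qed.

Lemma card_field_gt1 : (1 < q)%N.
Proof. by rewrite /plane_order (cardD1 0) (cardD1 1) !inE oner_eq0. Qed.

Lemma card_shared_plane : (q * q <= #|shared_edges plane|)%N.
Proof.
(* Each point is represented by the horizontal line through it. *)
pose f (p : 'I_q * F) := point_edge p.1 (0, p.2).
have f_inj : injective f.
  move=> [t y] [t' y'] /(congr1 fst); have := ltn_ord t; have := ltn_ord t'.
  move=> lt_t' lt_t /stop_inj[||/= et]; rewrite ?plane_color_point //=; try lia.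
  have {}et : t = t' by apply: val_inj => /=; lia.
  by rewrite et !mul0r !add0r => -[->].
rewrite -{1}(card_ord q) {2}/plane_order -card_prod -(card_codom f_inj).
apply/subset_leq_card/subsetP => _ /codomP[[t y] ->].
rewrite inE point_edge_in //=.
exact: leq_trans card_field_gt1 (card_lines_on_point _ _).
Qed.

Lemma shared_plane_point e : e \in shared_edges plane ->
  exists t l, (t < q)%N /\ e = point_edge t l.
Proof.
case: e => u v; rewrite inE => /andP[/layered_edgesP[k [l0 [lt_k -> ->]]]].
case/card_gt1P=> l [m []]; rewrite !inE /= !traverses_edge //.
move=> /andP[/eqP el /eqP el1] /andP[/eqP em /eqP em1] neq_lm.
(* An edge between two different columns cannot be shared, as its two ends determine the line. *)
have ek : uphalf k = uphalf k.+1.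
  apply: contraNeq neq_lm => neq_k.
  by apply/eqP/(column_color_sep neq_k);
    rewrite -!/(plane_color _) ?el ?em ?el1 ?em1.
exists k./2, l0; split; first by lia.
by rewrite /point_edge; have -> : k./2.*2.+1 = k by lia.
Qed.

Lemma point_crossings (s : solution plane) t l : consistent s -> (t < q)%N ->
  (q <= (3 * crossings s (point_edge t l)).+1)%N.
Proof.
move=> s_cons lt_t.
apply: leq_trans (card_lines_on_point l lt_t) (layered_crossings _ s_cons _ _ _ _);
  try lia; move=> x y e1 e2; apply: column_color_sep e1 e2; lia.
Qed.

Lemma plane_total_crossings (s : solution plane) : consistent s ->
  (q * #|shared_edges plane| <= 6 * total_crossings s)%N.
Proof.
move=> s_cons.
have sub_sh : {subset shared_edges plane <= edges plane}.
  by move=> e; rewrite inE => /andP[].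
apply: (@leq_trans (6 * \sum_(e in shared_edges plane) crossings s e)); last first.
  rewrite leq_mul2l /=.
  rewrite /total_crossings [X in (_ <= X)%N](big_setID (shared_edges plane)) /=.
  by rewrite (setIidPr _) ?leq_addr //; apply/subsetP.
rewrite mulnC -sum_nat_const big_distrr /= leq_sum // => e.
case/shared_plane_point=> t [l [lt_t ->]].
(* From q <= 3x + 1 and q >= 2 follow x >= 1 and q <= 6x, which absorbs the additive constant. *)
have := point_crossings l s_cons lt_t; have := card_field_gt1; lia.
Qed.

End AffinePlane.

(** * The infinite family over prime fields *)

Local Open Scope ring_scope.

Theorem theorem9 (R : realType) :
  exists F : nat -> instance,
    (forall n : nat,
       (n <= #|line (F n)|)%N /\ (n <= #|shared_edges (F n)|)%N) /\
    exists c : R, 0 < c /\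
      forall (n : nat) (s : solution (F n)), consistent s ->
        c * (#|line (F n)|%:R * Num.sqrt (#|shared_edges (F n)|%:R))
          <= (total_crossings s)%:R.
Proof.
pose p n := s2val (prime_above n).
have cardF n : #|'F_(p n)| = p n by rewrite card_Fp // /p; case: prime_above.
have lt_np n : (n < p n)%N by rewrite /p; case: prime_above.
have card_line n : #|line (plane 'F_(p n))| = (p n * p n)%N.
  by rewrite card_prod cardF.
have card_shared n := card_shared_plane 'F_(p n).
exists (fun n => plane 'F_(p n)); split=> [n|].
  have := card_shared n; rewrite /plane_order card_line cardF; have := lt_np n; nia.
exists 6^-1; split=> [|n s /plane_total_crossings]; first by rewrite invr_gt0.
have := card_shared n; rewrite /plane_order card_line cardF.
set S := #|_|; set t := total_crossings s => le_ppS.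
rewrite -(ler_nat R) !natrM => le_pS; rewrite ler_pdivrMl //.
apply: le_trans le_pS; rewrite -mulrA ler_wpM2l //.
(* With p^2 lines and p^2 <= S, it suffices that p <= sqrt S, after writing S as sqrt S * sqrt S. *)
rewrite -[leRHS]sqr_sqrtr // expr2 ler_wpM2r ?sqrtr_ge0 //.
by rewrite -[leLHS]ger0_norm // -sqrtr_sqr ler_wsqrtr // -natrX ler_nat.
Qed.
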